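(* Let $E$ be a Hausdorff space and let $\mathscr M_c$ be the class of completely metrizable spaces. The following are equivalent: (1) $E$ is a $C(\mathscr M_c)$-space. (2) Every $p$-complete $\delta$-sieve $(T,\phi)$ on $E$ which is a quasi-$\mu$-sieve is a $\mu$-sieve.
   Context: All topological spaces are Hausdorff. $\overline{A}$ denotes closure and $A^\circ$ interior. A mapping $f:F\to E$ is nearly continuous if $f^{-1}(V)\subseteq \left(\overline{f^{-1}(V)}\right)^\circ$ for every open $V\subseteq E$. For a class $\mathscr K$ of Hausdorff spaces, $E$ is a $C(\mathscr K)$-space if for every $F\in\mathscr K$, every nearly continuous mapping $f:F\to E$ with closed graph (graph closed in $F\times E$) is continuous. A sieve on $E$ is a pair $(T,\phi)$ where $T=(T,\leqslant_T)$ is a tree of height $\omega$ (not required to have a single root) and $\phi$ maps $T$ to the nonempty subsets of $E$ (not required to be open) such that $(s_1)$ $E=\bigcup\{\phi(t):t\in T\}$; $(s_2)$ for every $t\in T$, $\phi(t)=\bigcup\{\phi(s): t<_T s\in T\}$. A cofinal branch $b\subseteq T$ is a branch (maximal chain) meeting every level $n<\omega$. For a cofinal branch $b$ put $P(b)=\bigcap_{t\in b}\overline{\phi(t)}$. The sieve is $p$-complete if $\bigcap_{t\in b}\phi(t)\neq\emptyset$ for every cofinal branch $b$. It is a $\delta$-sieve if $P(b)$ contains at most one point for every cofinal branch $b$. It is a $\mu$-sieve if: for every open $U\subseteq E$, every $y\in U$ and every cofinal branch $b$ with $y\in P(b)$, there exists $t_0\in b$ such that $\phi(t_0)\subseteq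 U$. It is a quasi-$\mu$-sieve if: for every open $U\subseteq E$, every $y\in U$ and every cofinal branch $b$ with $y\in P(b)$, there exists $t_0\in b$ such that $U\cap\phi(t)\neq\emptyset$ for all $t\in T$ with $t_0<_T t$. *)

(* Defs.v *)
From HB Require Import structures.
From mathcomp Require Import all_boot all_order all_algebra.
From mathcomp Require Import all_classical all_reals all_analysis.

Set Implicit Arguments.
Unset Strict Implicit.
Unset Printing Implicit Defensive.

Import Order.TTheory.
Local Open Scope order_scope.
Local Open Scope classical_set_scope.

Definition nearly_continuous (F E : topologicalType) (f : F -> E) : Prop :=
  forall V : set E, open V -> f @^-1` V `<=` interior (closure (f @^-1` V)).

Definition closed_graph (F E : topologicalType) (f : F -> E) : Prop :=
  closed [set p : F * E | p.2 = f p.1].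

(* [K] is meant to be a class of Hausdorff spaces. *)
Definition C_space (K : topologicalType -> Prop) (E : topologicalType) : Prop :=
  forall F : topologicalType, K F ->
  forall f : F -> E, nearly_continuous f -> closed_graph f -> continuous f.

Definition homeomorphic (X Y : topologicalType) : Prop :=
  exists (f : X -> Y) (g : Y -> X),
    [/\ cancel f g, cancel g f, continuous f & continuous g].

(* The library's [completeType] is pointed, hence excludes the empty space; so
   completeness is stated here directly. *)
Definition complete_metric (R : realType) (M : metricType R) : Prop :=
  forall u : nat -> M, cauchy (u @ \oo) -> exists x : M, u @ \oo --> x.

Definition completely_metrizable (R : realType) (X : topologicalType) : Prop :=
  exists2 M : metricType R, complete_metric M & homeomorphic X M.

Lemma completely_metrizable_hausdorff (R : realType) (X : topologicalType) :
  completely_metrizable R X -> hausdorff_space X.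
Proof.
move=> [M _ [f [g [fK _ cf _]]]] p q pq.
apply: (can_inj fK); apply: (@metric_hausdorff R M) => A B Afp Bfq.
have [x [Ax Bx]] := pq _ _ (cf p A Afp) (cf q B Bfq).
by exists (f x).
Qed.

Section Trees.
Context {d : Order.disp_t} (T : porderType d).

(* Every set of predecessors is well-ordered. *)
Definition is_tree : Prop :=
  forall (t : T) (A : set T), A `<=` [set s | s < t] -> A !=set0 ->
  exists2 m : T, A m & forall s, A s -> m <= s.

(* The elements whose set of predecessors has order type [n]. *)
Definition tree_level (n : nat) : set T :=
  [set t | exists h : nat -> T,
     (forall i j, (i < n)%N -> (j < n)%N -> (h i < h j) = (i < j)%N) /\
     h @` `I_n = [set s | s < t]].

Definition tree_of_height_omega : Prop :=
  [/\ is_tree,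
      forall n : nat, tree_level n !=set0 &
      forall t : T, exists n : nat, tree_level n t].

(* A branch is a maximal chain. *)
Definition branch (b : set T) : Prop :=
  total_on b <=%O /\
  forall c : set T, total_on c <=%O -> b `<=` c -> c = b.

Definition cofinal_branch (b : set T) : Prop :=
  branch b /\ forall n : nat, b `&` tree_level n !=set0.

End Trees.

Section Sieves.
Context {E : topologicalType} {d : Order.disp_t} {T : porderType d}.
Variable phi : T -> set E.

Definition sieve : Prop :=
  [/\ tree_of_height_omega T,
      forall t, phi t !=set0,
      [set: E] = \bigcup_t phi t &
      forall t, phi t = \bigcup_(s in [set s | t < s]) phi s].

Definition branch_limits (b : set T) : set E := \bigcap_(t in b) closure (phi t).

Definition p_complete : Prop :=
  forall b, cofinal_branch b -> \bigcap_(t in b) phi t !=set0.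

Definition delta_sieve : Prop :=
  forall b, cofinal_branch b -> is_subset1 (branch_limits b).

Definition mu_sieve : Prop :=
  forall (U : set E) (y : E) (b : set T), open U -> U y ->
  cofinal_branch b -> branch_limits b y ->
  exists2 t0, b t0 & phi t0 `<=` U.

Definition quasi_mu_sieve : Prop :=
  forall (U : set E) (y : E) (b : set T), open U -> U y ->
  cofinal_branch b -> branch_limits b y ->
  exists2 t0, b t0 & forall t, t0 < t -> U `&` phi t !=set0.

End Sieves.

(* Main.v *)
From HB Require Import structures.
Require Import Defs.
From mathcomp Require Import all_boot all_order all_algebra.
From mathcomp Require Import all_classical all_reals all_analysis.

(** Both implications trade a map on a complete metric space for a sieve, the
points of the metric space corresponding to the cofinal branches of the tree.

From the mapping property to sieves: the cofinal branches of the tree, listed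
level by level, form a complete ultrametric space whose basic open sets consist
of the branches through a given node ([path_space_completely_metrizable]).
Completeness and the delta property of the sieve single out one point on each
branch, and the resulting map [path_point] sends the branches through [t] onto
[phi t] ([path_point_onto]).  Through this dictionary the quasi-mu property
gives near continuity, the delta property gives the closed graph, and
continuity of [path_point] gives the mu property.

From sieves to the mapping property: for a map [f] on a complete metric space,
take as nodes the finite sequences of balls in which the closure of every ball
lies inside its predecessor and the radii tend to zero, and attach to a node
the [f]-image of its last ball.  A cofinal branch shrinks to a point [y], and
the closed graph makes [f y] its only limit; near continuity of [f] is what the
quasi-mu property asks for; the mu property for a branch of balls centred at
[y] is continuity at [y] ([mu_sieve_continuous]).  These images cover only the
range of [f], whereas a sieve has to cover [E].  The points of [E] are
therefore added as letters that can only be repeated, which amounts to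
extending [f] by the identity on a disjoint discrete copy of [E]; the branches
so added have one-point cells and are harmless because [E] is Hausdorff. *)

Set Implicit Arguments.
Unset Strict Implicit.
Unset Printing Implicit Defensive.
Import Order.TTheory GRing.Theory Num.Theory.
Local Open Scope classical_set_scope.

(** * Levels and cofinal branches of a tree *)

Section TreeLevels.
Local Open Scope order_scope.
Context {d : Order.disp_t} {T : porderType d}.
Implicit Types (s t : T) (b : set T) (u : nat -> T).

Lemma tree_level_lt n t s : tree_level n t -> s < t ->
  exists2 m, (m < n)%N & tree_level m s.
Proof.
move=> [h [hlt him]] st; have : [set s | s < t] s by [].
rewrite -him => -[m /= mn hms]; exists m => //; exists h; split.
  by move=> i j im jm; apply: hlt; apply: (ltn_trans _ mn).
apply/seteqP; split=> r /=.
  by move=> [i im <-]; rewrite -hms hlt// (ltn_trans im).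
move=> rs; have : [set s | s < t] r by exact: lt_trans st.
rewrite -him => -[i /= iltn hir]; exists i => //.
by rewrite -(hlt i m)// hir hms.
Qed.

Lemma tree_level_below n t m : tree_level n t -> (m < n)%N ->
  exists2 s, s < t & tree_level m s.
Proof.
move=> [h [hlt him]] mn.
have hmt : [set s | s < t] (h m) by rewrite -him; exists m.
exists (h m) => //; exists h; split.
  by move=> i j im jm; apply: hlt; apply: (ltn_trans _ mn).
apply/seteqP; split=> r /=.
  by move=> [i im <-]; rewrite hlt// (ltn_trans im).
move=> rs; have : [set s | s < t] r by exact: lt_trans hmt.
rewrite -him => -[i /= iltn hir]; exists i => //.
by rewrite -(hlt i m)// hir.
Qed.

(** By induction on the smaller level: if [k < l] were both levels of [s], the
node of level [k] below [s] would also have a level below [k]. *)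
Lemma tree_level_inj m n t : tree_level m t -> tree_level n t -> m = n.
Proof.
have le k : forall l s, tree_level k s -> tree_level l s -> (l <= k)%N.
  elim/ltn_ind: k => k IH l s ks ls; rewrite leqNgt; apply/negP => kl.
  have [r rs kr] := tree_level_below ls kl.
  have [j jk jr] := tree_level_lt ks rs.
  by have := IH _ jk _ _ jr kr; rewrite leqNgt jk.
by move=> mt nt; apply/eqP; rewrite eqn_leq (le n m t) ?(le m n t).
Qed.

Definition down_chain u : set T := [set t | exists n, t <= u n].

Lemma chain_le u m n : (forall k, u k < u k.+1) -> (m <= n)%N -> u m <= u n.
Proof.
move=> ult; apply: (homo_leq (@lexx _ _) (fun y x z => @le_trans _ _ y x z)).
by move=> k; exact: ltW.
Qed.

Hypothesis hT : tree_of_height_omega T.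

(** A two-element set below [t] has a least element. *)
Lemma le_total_below s s' t : s <= t -> s' <= t -> s <= s' \/ s' <= s.
Proof.
have [hw _ _] := hT; rewrite le_eqVlt => /predU1P[->|st]; first by right.
rewrite le_eqVlt => /predU1P[->|s't]; first by left; exact: ltW.
have [|m [->|->] hm] := hw t [set s; s'] _ (ex_intro _ s (or_introl erefl)).
- by move=> r [->|->].
- by left; apply: hm; right.
- by right; apply: hm; left.
Qed.

Lemma tree_level_below_inj n s s' t : tree_level n s -> tree_level n s' ->
  s <= t -> s' <= t -> s = s'.
Proof.
have nlt (r r' : T) : tree_level n r -> tree_level n r' -> ~ r < r'.
  move=> nr nr' /(tree_level_lt nr')[m mn /(tree_level_inj nr) e].
  by rewrite e ltnn in mn.
move=> ns ns' st /(le_total_below st); rewrite !le_eqVlt.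
by move=> [/predU1P[//|/(nlt _ _ ns ns')]|/predU1P[//|/(nlt _ _ ns' ns)]].
Qed.

Lemma chain_index_le_level u j k : (forall n, u n < u n.+1) ->
  tree_level k (u j) -> (j <= k)%N.
Proof.
move=> ult; elim: j k => // j IH k /tree_level_lt /(_ (ult j))[m mk /IH jm].
exact: leq_ltn_trans mk.
Qed.

(** The downward closure is maximal: a node comparable with every [u n] and
below none of them would have infinitely many predecessors. *)
Lemma cofinal_branch_down_chain u :
  (forall n, u n < u n.+1) -> cofinal_branch (down_chain u).
Proof.
move=> ult; have [_ _ hlev] := hT.
have ule := fun m n => @chain_le u m n ult.
split; first split.
- move=> s t [m sm] [n tn].
  apply: (@le_total_below _ _ (u (maxn m n))).
    by apply: le_trans sm _; apply: ule; rewrite leq_maxl.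
  by apply: le_trans tn _; apply: ule; rewrite leq_maxr.
- move=> c ctot uc; apply/seteqP; split=> // t ct.
  have [n nt] := hlev t; exists n.
  have [//|] := ctot t (u n) ct (uc _ (ex_intro _ n (lexx _))).
  rewrite le_eqVlt => /predU1P[->//|/(tree_level_lt nt)[k kn]].
  by move=> /(chain_index_le_level ult); rewrite leqNgt kn.
- move=> n; have [k ku] := hlev (u n.+1).
  have [s su ns] := tree_level_below ku (chain_index_le_level ult ku).
  by exists s; split=> //; exists n.+1; exact: ltW.
Qed.

(** The nodes that a cofinal branch has on the successive levels form the
chain; maximality makes the branch downward closed. *)
Lemma cofinal_branch_chain b : cofinal_branch b ->
  exists u, [/\ forall n, tree_level n (u n), forall n, u n < u n.+1 &
                b = down_chain u].
Proof.
move=> [[btot bmax] bcof]; have [_ _ hlev] := hT.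
have [u ub] := choice bcof; exists u.
have ulev n := (ub n).2; have {ub}bu n := (ub n).1.
have ult n : u n < u n.+1.
  have [|] := btot _ _ (bu n) (bu n.+1); rewrite le_eqVlt => /predU1P[e|//].
  - have := tree_level_inj (ulev n.+1).
    by rewrite -e => /(_ _ (ulev n))/esym/n_Sn.
  - by have := tree_level_inj (ulev n.+1); rewrite e => /(_ _ (ulev n))/esym/n_Sn.
  move=> /(tree_level_lt (ulev n))[m mn /(tree_level_inj (ulev n.+1)) e].
  by move: mn; rewrite -e ltnNge leqnSn.
split=> //; symmetry; apply: bmax.
  by case: (cofinal_branch_down_chain ult) => -[].
move=> t bt; have [n nt] := hlev t; exists n.
have [//|] := btot _ _ bt (bu n).
rewrite le_eqVlt => /predU1P[->//|/(tree_level_lt nt)[k kn]].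
by move=> /(tree_level_inj (ulev n)) e; rewrite -e ltnn in kn.
Qed.

End TreeLevels.

(** * The metric space of infinite paths *)

Section PathSpace.
Local Open Scope ring_scope.

(** The real numbers [R] in which distances take their values are a parameter of
the type, so that the metric can be found by canonical structure inference. *)
Record path_space (R : realType) (A : Type) (edge : nat -> A -> A -> Prop) :=
  Path { path_fun :> nat -> A;
         path_edge : forall n, edge n (path_fun n) (path_fun n.+1) }.

Context {R : realType} {A : Type} {edge : nat -> A -> A -> Prop}.
Local Notation X := (path_space R edge).
Implicit Types (x y z : X).

Lemma path_ext x y : (forall n, x n = y n) -> x = y.
Proof.
case: x y => [u hu] [v hv] /= /funext uv; subst v.
by congr Path; exact: Prop_irrelevance.
Qed.

(** The inverse of the position, counted from one, of the first
disagreement. *)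
Definition path_dist x y : R :=
  if pselect (exists n, `[< x n <> y n >]) is left xy then (ex_minn xy).+1%:R^-1
  else 0.

Lemma path_distP x y : (x = y /\ path_dist x y = 0) \/
  exists m, [/\ x m <> y m, forall i, (i < m)%N -> x i = y i &
                path_dist x y = m.+1%:R^-1].
Proof.
rewrite /path_dist; case: pselect => [xy|nxy]; [right|left].
  case: ex_minnP => m /asboolP xym mmin; exists m; split=> // i im.
  apply: contrapT => /asboolP/mmin.
  by rewrite leqNgt im.
split=> //; apply: path_ext => n; apply: contrapT => xyn; apply: nxy.
by exists n; apply/asboolP.
Qed.

Lemma path_dist_lt x y n :
  (path_dist x y < n.+1%:R^-1) <-> forall i, (i <= n)%N -> x i = y i.
Proof.
have [[-> ->]|[m [xym xy ->]]] := path_distP x y; first by rewrite invr_gt0.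
rewrite ltf_pV2 ?posrE// ltr_nat ltnS; split=> [nm i ni|].
  by apply: xy; exact: leq_ltn_trans nm.
by move=> xyn; rewrite ltnNge; apply/negP => /xyn.
Qed.

Fact path_distxx x : path_dist x x = 0.
Proof. by have [[]|[m []]] := path_distP x x. Qed.

Fact path_dist_eq0 x y : path_dist x y = 0 -> x = y.
Proof.
have [[]//|[m [_ _ ->]]] := path_distP x y.
by move/eqP; rewrite invr_eq0 pnatr_eq0.
Qed.

Lemma path_dist_ge x y m : x m <> y m -> m.+1%:R^-1 <= path_dist x y.
Proof.
by move=> xy; rewrite leNgt; apply/negP => /path_dist_lt/(_ _ (leqnn m)).
Qed.

Fact path_dist_ge0 x y : 0 <= path_dist x y.
Proof. by have [[_ ->]//|[m [_ _ ->]]] := path_distP x y; rewrite invr_ge0. Qed.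

Fact path_distC x y : path_dist x y = path_dist y x.
Proof.
suff le x' y' : path_dist x' y' <= path_dist y' x'.
  by apply/eqP; rewrite eq_le !le.
have [[-> _]//|[m [xym _ ->]]] := path_distP x' y'.
by apply: path_dist_ge => yx; exact: xym.
Qed.

(** If [x] and [z] first differ at [m], then [y] differs at [m] from one of
them. *)
Fact path_dist_triangle y x z :
  path_dist x z <= path_dist x y + path_dist y z.
Proof.
have [[-> ->]|[m [xzm _ ->]]] := path_distP x z.
  by rewrite addr_ge0 ?path_dist_ge0.
have [xym|/path_dist_ge xym] := pselect (x m = y m).
  apply: ler_wpDl; first exact: path_dist_ge0.
  by apply: path_dist_ge; rewrite -xym.
by apply: ler_wpDr => //; exact: path_dist_ge0.
Qed.

HB.instance Definition _ := gen_eqMixin X.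
HB.instance Definition _ := gen_choiceMixin X.
HB.instance Definition _ := isMetric.Build R X
  path_distxx path_dist_eq0 path_distC path_dist_triangle.

Lemma path_ballE x n :
  ball x (n.+1%:R^-1 : R) = [set y | forall i, (i <= n)%N -> x i = y i].
Proof.
by rewrite ballEmdist; apply/seteqP; split=> y /=; move/path_dist_lt.
Qed.

Lemma nbhs_pathP x (B : set X) :
  nbhs x B <-> exists n, [set y : X | forall i, (i <= n)%N -> x i = y i] `<=` B.
Proof.
split=> [/nbhs_ballP[e/= e0 eB]|[n nB]].
  have [N _ /(_ N (leqnn N)) Ne] := near_infty_natSinv_lt (PosNum e0).
  exists N; rewrite -path_ballE; apply: subset_trans eB.
  by apply: le_ball; exact: ltW.
by apply/nbhs_ballP; exists n.+1%:R^-1; rewrite /= ?invr_gt0// path_ballE.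
Qed.

(** A Cauchy sequence is eventually constant in each coordinate.  The limit of
the coordinates is again a path since each edge condition involves two
coordinates only. *)
Lemma path_space_complete : complete_metric (path_space R edge).
Proof.
move=> u /cauchy_ballP uc.
have {uc}stab n : exists N, forall k l i, (N <= k)%N -> (N <= l)%N ->
    (i <= n)%N -> u k i = u l i.
  have n0 : (0 : R) < n.+1%:R^-1 by rewrite invr_gt0.
  have [[B C] /= [[N _ NB] [M _ MC]] BC] := uc _ n0.
  exists (maxn N M) => k l i; rewrite !geq_max => /andP[Nk Mk] /andP[Nl Ml] ik.
  have /= := BC (u k, u l) (conj (NB _ Nk) (MC _ Ml)).
  by rewrite path_ballE; exact.
have [N HN] := choice stab.
pose v n := u (N n) n.
have vE n i k : (i <= n)%N -> (N n <= k)%N -> u k i = v i.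
  move=> ik Nk.
  rewrite (HN n k (maxn (N i) (N n)) i)//; last by rewrite leq_maxr.
  by apply: HN => //; rewrite leq_maxl.
have vedge n : edge n (v n) (v n.+1).
  rewrite -(vE n.+1 n (N n.+1))// -(vE n.+1 n.+1 (N n.+1))//.
  exact: path_edge.
exists (Path _ vedge) => B /nbhs_pathP[n nB].
by exists (N n) => // k /= Nk; apply: nB => i /= ik; rewrite (vE n).
Qed.

Lemma path_space_completely_metrizable :
  completely_metrizable R (path_space R edge).
Proof.
exists (path_space R edge); first exact: path_space_complete.
by exists id, id; split=> // x; exact: cvg_id.
Qed.

End PathSpace.

(** * From the mapping property to sieves *)

Section BranchSpace.
Local Open Scope order_scope.
Context (R : realType) {E : topologicalType} {d : Order.disp_t}
        {T : porderType d} (phi : T -> set E).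
Hypotheses (hs : sieve phi) (hp : p_complete phi) (hd : delta_sieve phi).
Implicit Types (s t : T).

Definition covers_level (n : nat) s t :=
  [/\ tree_level n s, tree_level n.+1 t & s < t].

Local Notation X := (path_space R covers_level).
Implicit Types u v : X.

Lemma sieve_mono s t : s <= t -> phi t `<=` phi s.
Proof.
have [_ _ _ s2] := hs; rewrite le_eqVlt => /predU1P[->//|st] z tz.
by rewrite s2; exists t.
Qed.

Lemma path_level u n : tree_level n (u n).
Proof. by have [] := path_edge u n. Qed.

Lemma path_lt u n : u n < u n.+1.
Proof. by have [] := path_edge u n. Qed.

Lemma path_le u m n : (m <= n)%N -> u m <= u n.
Proof. exact: (chain_le (path_lt u)). Qed.

(** In a tree a node determines its predecessors, hence neighbourhoods of a
branch are given by single nodes. *)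
Lemma path_agree u v n : u n = v n -> forall i, (i <= n)%N -> u i = v i.
Proof.
have [hT _ _ _] := hs.
move=> uvn i ni; apply: (tree_level_below_inj hT (n := i) (t := u n)).
- exact: path_level.
- exact: path_level.
- exact: path_le.
- by rewrite uvn; exact: path_le.
Qed.

Lemma cofinal_branch_path b : cofinal_branch b -> exists u, b = down_chain u.
Proof.
have [hT _ _ _] := hs.
move=> /(cofinal_branch_chain hT)[u [ulev ult bE]].
by exists (@Path R _ _ u (fun n => And3 (ulev n) (ulev n.+1) (ult n))).
Qed.

Lemma path_cofinal_branch u : cofinal_branch (down_chain u).
Proof.
by have [hT _ _ _] := hs; apply: cofinal_branch_down_chain (path_lt u).
Qed.

(** The second sieve axiom moves [z] from a node to some strictly larger node,
possibly skipping levels; iterating from [t] gives a chain whose cells all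
contain [z], and its downward closure is the branch. *)
Lemma sieve_path_through k t z : tree_level k t -> phi t z ->
  exists2 u : X, u k = t & forall n, phi (u n) z.
Proof.
have [hT _ _ s2] := hs => kt tz.
have next (s : {s | phi s z}) : {s' : {s | phi s z} | sval s < sval s'}.
  case: s => s sz; have := sz; rewrite s2 => /cid2[s' ss' s'z].
  by exists (exist _ s' s'z).
have [w [w0 wlt]] := dependent_choice next (exist _ t tz).
have [u uE] := cofinal_branch_path (cofinal_branch_down_chain hT wlt).
exists u; last first.
  move=> n; have : down_chain u (u n) by exists n.
  by rewrite -uE => -[m /sieve_mono]; apply; exact: (svalP (w m)).
have : down_chain (sval \o w) t by exists 0%N; rewrite /= w0.
rewrite uE => -[n tn].
have kn : (k <= n)%N.
  move: tn; rewrite le_eqVlt => /predU1P[e|tn].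
    by rewrite (tree_level_inj kt (n := n)) // e; exact: path_level.
  have [m mn mt] := tree_level_lt (path_level u n) tn.
  by rewrite (tree_level_inj kt mt) ltnW.
exact: (tree_level_below_inj hT (path_level u k) kt (path_le u kn) tn).
Qed.

Lemma path_limit_unique u y z : (forall n, closure (phi (u n)) y) ->
  (forall n, closure (phi (u n)) z) -> y = z.
Proof.
have lim x : (forall n, closure (phi (u n)) x) ->
    branch_limits phi (down_chain u) x.
  by move=> ux t [n tn]; exact: (closure_subset (sieve_mono tn) (ux n)).
by move=> /lim uy /lim uz; exact: (hd (path_cofinal_branch u)).
Qed.

Lemma path_point_exists u : exists y, forall n, phi (u n) y.
Proof.
have [y uy] := hp (path_cofinal_branch u).
by exists y => n; apply: uy; exists n.
Qed.

Definition path_point u : E := projT1 (cid (path_point_exists u)).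

Lemma path_pointP u n : phi (u n) (path_point u).
Proof. by rewrite /path_point; case: cid. Qed.

Lemma path_point_eq u y : (forall n, closure (phi (u n)) y) -> path_point u = y.
Proof.
apply: path_limit_unique => n; apply: subset_closure; exact: path_pointP.
Qed.

Lemma path_point_onto k t z : tree_level k t -> phi t z ->
  exists2 u : X, u k = t & path_point u = z.
Proof.
move=> kt /(sieve_path_through kt)[u uk uz]; exists u => //.
by apply: path_point_eq => n; exact: subset_closure.
Qed.

(** Let [t0] be the node given by the quasi-mu property.  Every basic
neighbourhood of a branch through [t0] contains all branches through some
[t > t0]; as [phi t] meets [V], one of these is mapped into [V]. *)
Lemma path_point_nearly_continuous :
  quasi_mu_sieve phi -> nearly_continuous path_point.
Proof.
move=> hq V Vo u Vu.
have ulim : branch_limits phi (down_chain u) (path_point u).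
  move=> t [n tn]; apply: subset_closure; apply: (sieve_mono tn).
  exact: path_pointP.
have [t0 [n t0n] Vt] := hq _ _ _ Vo Vu (path_cofinal_branch u) ulim.
apply/nbhs_pathP; exists n => v /= uv B /nbhs_pathP[m mB].
(* One level more than both [m] and [n], to lie strictly above [t0]. *)
have lt_t0 : t0 < v (maxn n m).+1.
  apply: (le_lt_trans _ (path_lt _ _)); apply: (le_trans t0n).
  by rewrite uv// path_le// leq_maxl.
have [z [Vz /(path_point_onto (path_level v _))[w wk wz]]] := Vt _ lt_t0.
exists w; split; first by rewrite /= wz.
apply: mB => i im /=; apply: (path_agree (esym wk)).
by rewrite (leq_trans im)// leqW// leq_maxr.
Qed.

(** A point [(u, y)] in the closure of the graph has [y] in the closure of
every [phi (u n)], and [path_point u] is the only such point. *)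
Lemma path_point_closed_graph : closed_graph path_point.
Proof.
move=> [u y] /= cl; apply/esym/path_point_eq => n W Wy.
have [|[v z] /= [-> [vu Wv]]] :=
  cl ([set v : X | forall i, (i <= n)%N -> u i = v i] `*` W).
  exists ([set v : X | forall i, (i <= n)%N -> u i = v i], W) => //.
  by split=> //; apply/nbhs_pathP; exists n.
by exists (path_point v); split=> //; rewrite (vu n)//; exact: path_pointP.
Qed.

(** A neighbourhood of [u] mapped into [U] contains all the branches through
some [u n], and their points fill [phi (u n)]. *)
Lemma continuous_path_point_mu_sieve : continuous path_point -> mu_sieve phi.
Proof.
move=> hc U y b Uo Uy hb by_; have [u bE] := cofinal_branch_path hb.
rewrite bE in by_ *; have uy : path_point u = y.
  by apply: path_point_eq => n; apply: by_; exists n.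
have /hc : nbhs (path_point u) U by rewrite uy; exact: open_nbhs_nbhs.
move=> /nbhs_pathP[n nU]; exists (u n); first by exists n.
move=> z /(path_point_onto (path_level u n))[v vn <-]; apply: nU => /= i.
exact: path_agree.
Qed.

End BranchSpace.

Lemma C_space_mu_sieve (R : realType) (E : topologicalType)
    (d : Order.disp_t) (T : porderType d) (phi : T -> set E) :
  C_space (@completely_metrizable R) E ->
  sieve phi -> p_complete phi -> delta_sieve phi -> quasi_mu_sieve phi ->
  mu_sieve phi.
Proof.
move=> hC hs hp hd hq.
apply: (@continuous_path_point_mu_sieve R _ _ _ _ hs hp hd).
apply: hC; first exact: path_space_completely_metrizable.
- exact: path_point_nearly_continuous.
- exact: path_point_closed_graph.
Qed.

(** * The tree of finite words *)

Section WordTree.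
Local Open Scope order_scope.

(** A word stands for the nonempty list [letter 0, ..., letter depth].  Letters
past [depth] repeat the last one, so that words with the same list are equal
and no default letter is needed. *)
Record word (A : Type) (edge : nat -> A -> A -> Prop) := Word {
  depth : nat;
  letter : nat -> A;
  letter_stop : forall i, letter i = letter (minn i depth);
  letter_edge : forall i, (i < depth)%N -> edge i (letter i) (letter i.+1) }.

Context {A : Type} {edge : nat -> A -> A -> Prop}.
Local Notation W := (word edge).
Implicit Types (s t r : W) (u : nat -> A).

HB.instance Definition _ := gen_eqMixin W.
HB.instance Definition _ := gen_choiceMixin W.

Lemma word_ext s t : depth s = depth t ->
  (forall i, (i <= depth s)%N -> letter s i = letter t i) -> s = t.
Proof.
case: s t => [n u us ue] [m v vs ve] /= nm; subst m => uv.
have {}uv : u = v by apply/funext => i; rewrite us vs uv// geq_minr.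
by subst v; congr Word; exact: Prop_irrelevance.
Qed.

Definition le_word s t : bool :=
  (depth s <= depth t)%N &&
  `[< forall i, (i <= depth s)%N -> letter s i = letter t i >].

Fact le_word_refl : reflexive le_word.
Proof. by move=> s; rewrite /le_word leqnn; apply/asboolP. Qed.

Fact le_word_anti : antisymmetric le_word.
Proof.
move=> s t /andP[/andP[st /asboolP e] /andP[ts _]].
by apply: word_ext => //; apply/eqP; rewrite eqn_leq st.
Qed.

Fact le_word_trans : transitive le_word.
Proof.
move=> t s r /andP[st /asboolP est] /andP[tr /asboolP etr].
rewrite /le_word (leq_trans st tr); apply/asboolP => i si.
by rewrite est// etr// (leq_trans si).
Qed.

Fact word_display : Order.disp_t. Proof. exact: Order.Disp tt tt. Qed.

HB.instance Definition _ := Order.Le_isPOrder.Build word_display W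
  le_word_refl le_word_anti le_word_trans.

Lemma le_wordP s t : s <= t <->
  (depth s <= depth t)%N /\
  forall i, (i <= depth s)%N -> letter s i = letter t i.
Proof.
by split=> [/andP[st /asboolP]|[st e]] //; apply/andP; split=> //; apply/asboolP.
Qed.

Lemma lt_word_depth s t : s < t -> (depth s < depth t)%N.
Proof.
rewrite lt_neqAle => /andP[/eqP st /le_wordP[le e]].
rewrite ltn_neqAle le andbT; apply/eqP => de; apply: st.
exact: word_ext.
Qed.

Lemma lt_word s t : s <= t -> (depth s < depth t)%N -> s < t.
Proof.
by move=> st; rewrite lt_neqAle st andbT; apply: contraTneq => ->; rewrite ltnn.
Qed.

Lemma le_word_common s r t :
  s <= t -> r <= t -> (depth s <= depth r)%N -> s <= r.
Proof.
move=> /le_wordP[_ st] /le_wordP[_ rt] sr; apply/le_wordP; split=> // i si.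
by rewrite st// rt// (leq_trans si).
Qed.

Fact prefix_stop u n i : u (minn i n) = u (minn (minn i n) n).
Proof. by rewrite -minnA minnn. Qed.

Fact prefix_edge u n (ue : forall i, (i < n)%N -> edge i (u i) (u i.+1)) i :
  (i < n)%N -> edge i (u (minn i n)) (u (minn i.+1 n)).
Proof.
by move=> ilt; rewrite (minn_idPl (ltnW ilt)) (minn_idPl ilt); exact: ue.
Qed.

Definition prefix u n ue : W := Word (prefix_stop u n) (@prefix_edge u n ue).

Lemma letter_prefix u n ue i : (i <= n)%N -> letter (@prefix u n ue) i = u i.
Proof. by move=> /minn_idPl /= ->. Qed.

Lemma cut_exists t n : (n <= depth t)%N -> exists2 s, s <= t & depth s = n.
Proof.
move=> nt; have ue i : (i < n)%N -> edge i (letter t i) (letter t i.+1).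
  by move=> ilt; apply: letter_edge; exact: leq_trans nt.
exists (prefix ue) => //; apply/le_wordP; split=> // i ni.
by rewrite letter_prefix.
Qed.

Lemma word_is_tree : is_tree W.
Proof.
move=> t B Bt [s0 Bs0].
have ex : exists n, `[< exists2 s, B s & depth s = n >].
  by exists (depth s0); apply/asboolP; exists s0.
case: (ex_minnP ex) => n /asboolP[m Bm mn] nmin; exists m => // s Bs.
apply: (le_word_common (t := t)); [exact/ltW/Bt|exact/ltW/Bt|].
by rewrite mn; apply: nmin; apply/asboolP; exists s.
Qed.

Lemma word_level t : tree_level (depth t) t.
Proof.
have /choice[h hP] n : exists s, (n < depth t)%N -> s <= t /\ depth s = n.
  by have [nt|] := boolP (n < depth t)%N;
     [have [s ? ?] := cut_exists (ltnW nt); exists s|exists t].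
exists h; split.
  move=> i j /hP[hit hi] /hP[hjt hj]; apply/idP/idP.
    by move/lt_word_depth; rewrite hi hj.
  move=> ij; have dij : (depth (h i) < depth (h j))%N by rewrite hi hj.
  exact: lt_word (le_word_common hit hjt (ltnW dij)) dij.
apply/seteqP; split=> s /=.
  by move=> [i it <-]; have [hit hi] := hP i it; apply: (lt_word hit); rewrite hi.
move=> st; have dst := lt_word_depth st; have [hst hs] := hP _ dst.
exists (depth s) => //; apply/le_anti/andP; split.
  by apply: (le_word_common hst (ltW st)); rewrite hs.
by apply: (le_word_common (ltW st) hst); rewrite hs.
Qed.

Lemma word_levelE n t : tree_level n t -> depth t = n.
Proof. by move=> nt; exact: tree_level_inj (word_level t) nt. Qed.

Lemma word_invariant (Q : A -> Prop) s t :
  (forall n a b, edge n a b -> Q a -> Q b) -> s <= t ->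
  Q (letter s (depth s)) -> Q (letter t (depth t)).
Proof.
move=> Qe /le_wordP[st e]; rewrite e// => Qs.
suff: forall n, (n <= depth t)%N -> (depth s <= n)%N -> Q (letter t n) by exact.
elim=> [|n IH]; first by rewrite leqn0 => _ /eqP s0; rewrite s0 in Qs.
move=> nt; rewrite leq_eqVlt => /predU1P[<-//|sn].
by apply: Qe (letter_edge nt) _; apply: IH => //; exact: ltnW.
Qed.

Hypothesis edge_total : forall n a, exists b, edge n a b.

Lemma word_tree_height_omega (a0 : A) : tree_of_height_omega W.
Proof.
split; first exact: word_is_tree; last first.
  by move=> t; exists (depth t); exact: word_level.
(* Edges depend on their position, so the position is carried along. *)
have next (p : nat * A) : {q : nat * A | q.1 = p.1.+1 /\ edge p.1 p.2 q.2}.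
  by have [b pb] := cid (edge_total p.1 p.2); exists (p.1.+1, b).
have [p [p0 pS]] := dependent_choice next (0%N, a0).
have pn n : (p n).1 = n by elim: n => [|n IH]; rewrite ?p0// (pS n).1 IH.
move=> n; have ue i : (i < n)%N -> edge i (p i).2 (p i.+1).2.
  by move=> _; have := (pS i).2; rewrite pn.
pose t := prefix (u := fun i => (p i).2) ue.
by exists t; exact: (word_level t).
Qed.

Definition spells (b : set W) u :=
  (forall t, b t -> letter t (depth t) = u (depth t)) /\
  (forall n, exists2 t, b t & depth t = n).

Lemma cofinal_branch_spells (a0 : A) (b : set W) : cofinal_branch b ->
  exists2 u, forall n, edge n (u n) (u n.+1) & spells b u.
Proof.
have hT := word_tree_height_omega a0.
move=> /(cofinal_branch_chain hT)[w [wlev wlt ->]].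
have wd n : depth (w n) = n by exact: word_levelE.
have wle := fun m n => @chain_le _ _ w m n wlt.
have wE m n : (m <= n)%N -> letter (w m) m = letter (w n) m.
  by move=> /wle/le_wordP[_ e]; apply: e; rewrite wd.
exists (fun n => letter (w n) n) => [n|].
  by rewrite (wE n n.+1)//; apply: letter_edge; rewrite wd.
split=> [t [n /le_wordP[tn e]]|n]; last by exists (w n) => //; exists n.
by rewrite e// (wE _ n)// -(wd n).
Qed.

Lemma spelled_branch u : (forall n, edge n (u n) (u n.+1)) ->
  exists2 b : set W, cofinal_branch b & spells b u.
Proof.
move=> ue; pose w n : W := prefix (fun i (_ : (i < n)%N) => ue i).
have wlt n : w n < w n.+1.
  apply: lt_word => //; apply/le_wordP; split=> //= i ni.
  by rewrite !(minn_idPl _)// ltnW.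
have hw := cofinal_branch_down_chain (word_tree_height_omega (u 0%N)) wlt.
exists (down_chain w); first by [].
split=> [t [n /le_wordP[tn e]]|n]; last by exists (w n) => //; exists n.
by rewrite e// letter_prefix.
Qed.

Section WordSieve.
Context {E : topologicalType} (cell : A -> set E).
Hypothesis cell0 : forall a, cell a !=set0.
Hypothesis cellT : [set: E] = \bigcup_a cell a.
Hypothesis cell_step : forall n a, cell a = \bigcup_(b in edge n a) cell b.

Definition word_cell t : set E := cell (letter t (depth t)).

Lemma word_cell_mono s t : s <= t -> word_cell t `<=` word_cell s.
Proof.
move=> st.
apply: (word_invariant (Q := fun a => cell a `<=` word_cell s)) st _ => //.
move=> n a b ab as_; apply: subset_trans as_; rewrite (cell_step n a).
by move=> z bz; exists b.
Qed.

Lemma word_cell_sieve (a0 : A) : sieve word_cell.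
Proof.
split; first exact: word_tree_height_omega.
- by move=> t; exact: cell0.
- rewrite cellT; apply/seteqP; split=> z [a _ az]; last first.
    by exists (letter a (depth a)).
  have ue i : (i < 0)%N -> edge i a a by [].
  by exists (prefix (u := fun=> a) ue).
- move=> t; apply/seteqP; split=> [z|z [s /= /ltW/word_cell_mono]]; last exact.
  rewrite {1}/word_cell (cell_step (depth t)) => -[b tb bz].
  (* The word [t] followed by the letter [b]. *)
  pose v i := if (i <= depth t)%N then letter t i else b.
  have ve i : (i < (depth t).+1)%N -> edge i (v i) (v i.+1).
    rewrite /v ltnS => it; rewrite it; case: ltnP => [|ti].
      exact: letter_edge.
    by have -> : i = depth t by apply/eqP; rewrite eqn_leq it.
  exists (prefix ve).
    apply: lt_word => //; apply/le_wordP; split=> //= i it.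
    by rewrite (minn_idPl _) ?leqW// /v it.
  by rewrite /word_cell letter_prefix//= /v ltnn.
Qed.

End WordSieve.
End WordTree.

(** * From sieves to the mapping property *)

Section BallSieve.
Local Open Scope ring_scope.
Context {R : realType} {M : metricType R} {E : topologicalType} (f : M -> E).

(** The alphabet.  Coding a ball by its centre and radius makes it open and
nonempty by construction; the points of [E] are there to make the cells cover
[E] when [f] is not surjective. *)
Definition cell_code : Type := ((M * {posnum R}) + E)%type.
Implicit Types (a : cell_code) (u : nat -> cell_code).

Definition cell a : set E :=
  match a with inl (x, r) => f @` ball x r%:num | inr e => [set e] end.

(** The closure condition puts the limit of the centres into every ball; the
radius bound makes the centres a Cauchy sequence and the balls a neighbourhood
base of the limit. *)
Definition refines (n : nat) a a' : Prop :=
  match a, a' with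
  | inl (x, r), inl (x', r') =>
      closed_ball x' r'%:num `<=` ball x r%:num /\ r'%:num <= n.+1%:R^-1
  | inr e, inr e' => e = e'
  | _, _ => False
  end.

Lemma refines_ball n (x : M) (r : {posnum R}) w : ball x r%:num w ->
  exists r', refines n (inl (x, r)) (inl (w, r')).
Proof.
rewrite ballEmdist /= => xw; have e0 : 0 < r%:num - mdist x w by rewrite subr_gt0.
pose e := PosNum e0; have r0 : 0 < Num.min (e%:num / 2) n.+1%:R^-1.
  by rewrite lt_min divr_gt0// invr_gt0 ltr0n.
exists (PosNum r0); split=> /=; last by rewrite ge_min lexx orbT.
move=> z zw; have : closed_ball w (e%:num / 2) z.
  by apply: (closure_subset _ zw); apply: le_ball; rewrite ge_min lexx.
move=> /(subset_closure_half e0); rewrite !ballEmdist /= => wz.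
apply: le_lt_trans (metric_triangle x w z) _.
by rewrite addrC -ltrBrDr.
Qed.

Lemma refines_total n a : exists a', refines n a a'.
Proof.
case: a => [[x r]|e]; last by exists (inr e).
have [r' xr'] := refines_ball n (@ballxx _ _ x r%:num (gt0 r)).
by exists (inl (x, r')).
Qed.

Lemma cell_nonempty a : cell a !=set0.
Proof.
by case: a => [[x r]|e]; [exists (f x), x => //; exact: ballxx|exists e].
Qed.

(** Every point of a ball is the centre of a smaller one with closure inside;
taking images commutes with unions. *)
Lemma cell_refines n a : cell a = \bigcup_(a' in refines n a) cell a'.
Proof.
apply/seteqP; split.
  case: a => [[x r] z [w xw <-]|e z ez]; last by exists (inr e).
  have [r' wr'] := refines_ball n xw; exists (inl (w, r')) => //.
  by exists w => //; exact: ballxx.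
move=> z [] [[x' r']|e'] /=; case: a => [[x r]|e] //=; last by move=> ->.
by move=> [x'x _] [w x'w <-]; exists w => //; apply/x'x/subset_closure.
Qed.

Lemma cell_cover : [set: E] = \bigcup_a cell a.
Proof. by apply/seteqP; split=> // e _; exists (inr e). Qed.

Lemma refining_inr e u : (forall n, refines n (u n) (u n.+1)) ->
  u 0%N = inr e -> forall n, u n = inr e.
Proof.
move=> ue u0; elim=> // n IH; have := ue n; rewrite IH.
by case: (u n.+1) => [[? ?]|e'] //= ->.
Qed.

Lemma refining_inl p u : (forall n, refines n (u n) (u n.+1)) ->
  u 0%N = inl p -> exists c : nat -> M * {posnum R}, forall n, u n = inl (c n).
Proof.
move=> ue u0; suff /choice[c cE] : forall n, exists q, u n = inl q by exists c.
elim=> [|n [q IH]]; first by exists p.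
have := ue n; rewrite IH; case: q {IH} => x r.
by case: (u n.+1) => [q'|//] _; exists q'.
Qed.

Section NestedBalls.
Context (x : nat -> M) (r : nat -> {posnum R}).
Hypothesis nested : forall n, refines n (inl (x n, r n)) (inl (x n.+1, r n.+1)).

Lemma nested_ball_le m n : (m <= n)%N ->
  ball (x n) (r n)%:num `<=` ball (x m) (r m)%:num.
Proof.
apply: (homo_leq (r := fun B C : set M => C `<=` B)
  (f := fun n => ball (x n) (r n)%:num)).
- by move=> B; exact: subset_refl.
- by move=> B C D CB DC; exact: subset_trans DC CB.
- move=> k; have [kS _] := nested k.
  by apply: subset_trans kS; exact: subset_closure.
Qed.

Lemma nested_ball_limit : complete_metric M ->
  exists y, forall n, ball (x n) (r n)%:num y.
Proof.
move=> hM; have [|y xy] := hM x.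
  apply: cauchy_exP => e e0.
  have [N _ /(_ N (leqnn N)) /= Ne] := near_infty_natSinv_lt (PosNum e0).
  exists (x N.+1), N.+1 => // n /= Nn.
  have [_ rN] := nested N; apply: (@le_ball _ _ _ (r N.+1)%:num).
    exact: le_trans (ltW Ne).
  by apply: nested_ball_le Nn _ _; exact: ballxx.
exists y => n; have [nS _] := nested n; apply: nS => B /xy[N _ NB].
exists (x (maxn N n.+1)); split; last by apply: NB; rewrite /= leq_maxl.
by apply: (@nested_ball_le n.+1 (maxn N n.+1)); [rewrite leq_maxr|exact: ballxx].
Qed.

Lemma nested_ball_nbhs y B : (forall n, ball (x n) (r n)%:num y) -> nbhs y B ->
  exists n, ball (x n) (r n)%:num `<=` B.
Proof.
move=> xy /nbhs_ballP[e /= e0 eB].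
have e20 : 0 < e / 2 by rewrite divr_gt0.
have [N _ /(_ N (leqnn N)) /= Ne] := near_infty_natSinv_lt (PosNum e20).
(* Points of a ball are at a distance less than twice its radius. *)
exists N.+1 => z xz; apply: eB; have [_ rN] := nested N.
have rle := le_trans rN (ltW Ne).
rewrite [e]splitr; apply: (@ball_triangle _ _ (x N.+1)).
  by apply: ball_sym; apply: le_ball rle _ (xy _).
exact: le_ball rle _ xz.
Qed.

End NestedBalls.

Local Notation phi := (word_cell (edge := refines) cell).

Definition shrinks_to (b : set (word refines)) (y : M) : Prop :=
  (forall t, b t ->
    exists x r, letter t (depth t) = inl (x, r) /\ ball x r%:num y) /\
  forall B, nbhs y B -> exists t x r,
    [/\ b t, letter t (depth t) = inl (x, r) & ball x r%:num `<=` B].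

(** An edge never joins a ball to a point of [E], so a branch contains letters
of one kind only; for balls, completeness provides the limit point. *)
Lemma ball_branch_cases (a0 : cell_code) (b : set (word refines)) :
  complete_metric M -> cofinal_branch b ->
  (exists e, forall t, b t -> letter t (depth t) = inr e) \/
  exists y, shrinks_to b y.
Proof.
move=> hM hb.
have [u ue [bu ub]] := cofinal_branch_spells refines_total a0 hb.
case u0 : (u 0%N) => [p|e]; [right|left]; last first.
  by exists e => t /bu ->; exact: refining_inr.
have [c cE] := refining_inl ue u0.
pose x n := (c n).1; pose r n := (c n).2.
have {}cE n : u n = inl (x n, r n) by rewrite cE /x /r -surjective_pairing.
have nested n : refines n (inl (x n, r n)) (inl (x n.+1, r n.+1)).
  by rewrite -!cE.
have [y xy] := nested_ball_limit nested hM; exists y; split.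
  by move=> t /bu ->; exists (x (depth t)), (r (depth t)).
move=> B /(nested_ball_nbhs nested xy)[n nB].
have [t bt tn] := ub n; exists t, (x n), (r n); split=> //.
by rewrite bu// tn.
Qed.

(** The balls of radius [2^-n] centred at [y]: halving the radius makes the
closed ball fit into the previous ball. *)
Lemma ball_branch_at (y : M) :
  exists2 b : set (word refines), cofinal_branch b & shrinks_to b y.
Proof.
have half0 n : 0 < (2^-1 : R) ^+ n by rewrite exprn_gt0// invr_gt0.
pose u n : cell_code := inl (y, PosNum (half0 n)).
have ue n : refines n (u n) (u n.+1).
  split=> /=; first by rewrite exprSr; exact: subset_closure_half.
  by rewrite exprVn lef_pV2 ?posrE ?exprn_gt0// -natrX ler_nat ltnW// ltn_expl.
have [b hb [bu ub]] := spelled_branch refines_total ue.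
exists b => //; split.
  move=> t /bu ->; exists y, (PosNum (half0 (depth t))).
  by split=> //; exact: ballxx.
have yy n := ballxx y (half0 n).
move=> B By; have [n nB] := @nested_ball_nbhs (fun=> y) _ ue y B yy By.
have [t bt tn] := ub n; exists t, y, (PosNum (half0 n)); split=> //.
by rewrite bu// tn.
Qed.

(** The point [(y, z)] lies in the closure of the graph: a small ball of the
branch lies in a given neighbourhood of [y], and its image meets every
neighbourhood of [z]. *)
Lemma shrinks_to_limit b y z : closed_graph f -> shrinks_to b y ->
  branch_limits phi b z -> z = f y.
Proof.
move=> fcg [_ by_] bz; apply: (fcg (y, z)) => B [[U V] /= [Uy Vz] UVB].
have [t [x [r [bt tE xU]]]] := by_ U Uy.
have [v [tv Vv]] := bz t bt V Vz.
move: tv; rewrite /word_cell tE => -[w xw wv].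
exists (w, f w); split=> //; apply: UVB; split; first exact: xU.
by rewrite /= wv.
Qed.

Lemma constant_branch_limit b e z : hausdorff_space E -> cofinal_branch b ->
  (forall t, b t -> letter t (depth t) = inr e) -> branch_limits phi b z ->
  z = e.
Proof.
move=> hE [_ bcof] be bz; have [t [bt _]] := bcof 0%N.
have := bz t bt; rewrite /word_cell be// /cell.
have /closure_id <- // : closed [set e].
exact/accessible_closed_set1/hausdorff_accessible.
Qed.

Lemma ball_sieve_p_complete (a0 : cell_code) :
  complete_metric M -> p_complete phi.
Proof.
move=> hM b hb; have [[e be]|[y [yb _]]] := ball_branch_cases a0 hM hb.
  by exists e => t /be; rewrite /word_cell => ->.
exists (f y) => t /yb[x [r [tE xy]]].
by rewrite /word_cell tE; exists y.
Qed.

Lemma ball_sieve_delta (a0 : cell_code) : complete_metric M ->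
  hausdorff_space E -> closed_graph f -> delta_sieve phi.
Proof.
move=> hM hE fcg b hb z z' bz bz'.
have [[e be]|[y yb]] := ball_branch_cases a0 hM hb.
  rewrite (constant_branch_limit hE hb be bz).
  by rewrite (constant_branch_limit hE hb be bz').
by rewrite (shrinks_to_limit fcg yb bz) (shrinks_to_limit fcg yb bz').
Qed.

(** Some ball of the branch lies in the closure of [f @^-1` U], and so does
every ball refining it; being open and nonempty, such a ball meets
[f @^-1` U]. *)
Lemma ball_sieve_quasi_mu (a0 : cell_code) : complete_metric M ->
  hausdorff_space E -> nearly_continuous f -> closed_graph f ->
  quasi_mu_sieve phi.
Proof.
move=> hM hE fnc fcg U z b Uo Uz hb bz.
have [[e be]|[y yb]] := ball_branch_cases a0 hM hb.
  have [t0 [bt0 _]] := hb.2 0%N; exists t0 => // t t0t; exists z; split=> //.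
  have tail := word_invariant (Q := fun a => a = inr e) _ (ltW t0t) (be _ bt0).
  rewrite /word_cell tail; first exact: constant_branch_limit bz.
  by move=> n a a' + ae; rewrite ae; case: a' => [[? ?]|e'] //= ->.
have zE := shrinks_to_limit fcg yb bz; rewrite zE in Uz.
have [t0 [x [r [bt0 t0E xU]]]] := yb.2 _ (fnc U Uo y Uz).
exists t0 => // t t0t.
have [x' [r' [tE x'U]]] : exists x' r', letter t (depth t) = inl (x', r') /\
    ball x' r'%:num `<=` closure (f @^-1` U).
  pose Q a := exists x' r', a = inl (x', r') /\
    ball x' r'%:num `<=` closure (f @^-1` U).
  apply: (word_invariant (Q := Q) _ (ltW t0t)); last by exists x, r.
  move=> n a a' aa' [x1 [r1 [ae x1U]]]; move: aa'; rewrite ae.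
  case: a' => [[x2 r2]|//] /= [sub _].
  exists x2, r2; split=> //; apply: subset_trans x1U.
  by apply: subset_trans sub; exact: subset_closure.
have r'0 : 0 < r'%:num by exact: gt0.
have [w [Uw x'w]] := x'U x' (ballxx _ r'0) _ (nbhsx_ballx x' _ r'0).
by exists (f w); split=> //; rewrite /word_cell tE; exists w.
Qed.

(** The branch of balls centred at [y] has the limit [f y]; the node supplied
by the mu property is a ball around [y] mapped into [U]. *)
Lemma mu_sieve_continuous : mu_sieve phi -> continuous f.
Proof.
move=> hmu y V; rewrite nbhsE => -[U [Uo Uy] UV].
have [b hb yb] := ball_branch_at y.
have ylim : branch_limits phi b (f y).
  move=> t /yb.1 [x [r [tE xy]]]; apply: subset_closure.
  by rewrite /word_cell tE; exists y.
have [t0 /yb.1[x [r [tE xy]]] tU] := hmu U (f y) b Uo Uy hb ylim.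
have [r' [sub _]] := refines_ball 0 xy.
apply/nbhs_ballP; exists r'%:num => //= w xw; apply: UV; apply: tU.
by rewrite /word_cell tE; exists w => //; apply/sub/subset_closure.
Qed.

End BallSieve.

Lemma nearly_continuous_comp (X F E : topologicalType) (f : F -> E)
    (g : X -> F) (k : F -> X) :
  cancel g k -> cancel k g -> continuous g -> continuous k ->
  nearly_continuous f -> nearly_continuous (f \o g).
Proof.
move=> gK kK cg ck fnc V Vo x /= Vx.
have : nbhs x (g @^-1` closure (f @^-1` V)).
  by exact: cg (fnc V Vo (g x) Vx).
rewrite /interior /=; apply: filterS => z /= cz B Bz.
have [w [Vw Bw]] : f @^-1` V `&` k @^-1` B !=set0.
  by apply: cz; apply: ck; rewrite gK.
by exists (k w); split=> //=; rewrite kK.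
Qed.

Lemma closed_graph_comp (X F E : topologicalType) (f : F -> E) (g : X -> F) :
  continuous g -> closed_graph f -> closed_graph (f \o g).
Proof.
move=> cg fcg [x y] cl; apply: (fcg (g x, y)) => B [[U V] /= [Ux Vy] UVB].
have [|[w z] /= [-> [Uw Vz]]] := cl ((g @^-1` U) `*` V).
  by exists (g @^-1` U, V) => //; split=> //; exact: cg.
by exists (g w, f (g w)); split=> //; apply: UVB.
Qed.

Lemma mu_sieves_C_space (R : realType) (E : topologicalType) :
  hausdorff_space E ->
  (forall (d : Order.disp_t) (T : porderType d) (phi : T -> set E),
     sieve phi -> p_complete phi -> delta_sieve phi -> quasi_mu_sieve phi ->
     mu_sieve phi) ->
  C_space (@completely_metrizable R) E.
Proof.
move=> hE hmu F [M hM [k [g [kK gK ck cg]]]] f fnc fcg.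
have gnc := nearly_continuous_comp gK kK cg ck fnc.
have gcg := closed_graph_comp cg fcg.
suff cfg : continuous (f \o g).
  have -> : f = (f \o g) \o k by apply/funext => z /=; rewrite kK.
  by move=> z; apply: continuous_comp; [exact: ck|exact: cfg].
(* The levels of a tree are nonempty; the point [x] provides a letter. *)
move=> x; have a0 : @cell_code R M E := inr (f (g x)).
move: x; apply: mu_sieve_continuous; apply: hmu.
- apply: word_cell_sieve a0.
  + exact: refines_total.
  + exact: cell_nonempty.
  + exact: cell_cover.
  + exact: cell_refines.
- exact: ball_sieve_p_complete.
- exact: ball_sieve_delta.
- exact: ball_sieve_quasi_mu.
Qed.

Theorem theorem3 (R : realType) (E : topologicalType) (hE : hausdorff_space E) :
  C_space (@completely_metrizable R) E <->
  (forall (d : Order.disp_t) (T : porderType d) (phi : T -> set E),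
     sieve phi -> p_complete phi -> delta_sieve phi -> quasi_mu_sieve phi ->
     mu_sieve phi).
Proof.
split; last exact: mu_sieves_C_space.
by move=> hC d T phi; exact: (C_space_mu_sieve hC).
Qed.
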